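(* Let $X$ be a set equipped with the cofinite topology. The sobrification rank $\mathrm{sob}\, X$ is $0$ if $X$ is empty, $1$ if $X$ is finite and non-empty, and $2$ if $X$ is infinite.
   Context: In the cofinite topology on a set $X$, the closed subsets are exactly the finite subsets of $X$ and $X$ itself; such a space is always Noetherian (every open subset is compact). For a well-founded poset $P$ and $x \in P$, $\mathrm{rk}_P(x) = \sup_{x' < x} (\mathrm{rk}_P(x')+1)$ and the ordinal rank of $P$ is $|P| = \sup_{x \in P} (\mathrm{rk}_P(x)+1)$, where $\sup\emptyset = 0$. A closed subset $C$ of $X$ is irreducible if it is non-empty and, whenever $C \subseteq F_1 \cup F_2$ with $F_1, F_2$ closed in $X$, we have $C \subseteq F_1$ or $C \subseteq F_2$. $\mathcal{S} X$ is the poset of irreducible closed subsets of $X$, ordered by inclusion (well-founded when $X$ is Noetherian). The sobrification rank of a Noetherian space $X$ is $\mathrm{sob}\, X = |\mathcal{S} X|$. *)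

(* Defs.v *)
From HB Require Import structures.
From mathcomp Require Import all_boot all_order.
From mathcomp Require Import all_classical topology.

Set Implicit Arguments.
Unset Strict Implicit.
Unset Printing Implicit Defensive.

Import Order.TTheory.
Local Open Scope classical_set_scope.

(* Ordinals are represented by well-founded trees: [Ord_of f] stands for
   sup_i (f i + 1), that is, the least ordinal above all the [f i].  Distinct
   trees may represent the same ordinal; equality of ordinals is [oeq]. *)
Inductive Ord : Type := Ord_of (I : Type) (f : I -> Ord).

Fixpoint ole (a b : Ord) {struct a} : Prop :=
  match a, b with
  | Ord_of _ f, Ord_of _ g => forall i, exists j, ole (f i) (g j)
  end.

Definition olt (a b : Ord) : Prop :=
  match b with Ord_of _ g => exists j, ole a (g j) end.

Definition oeq (a b : Ord) : Prop := ole a b /\ ole b a.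

Definition ozero : Ord := Ord_of (fun e : Empty_set => match e with end).

Definition osucc (a : Ord) : Ord := Ord_of (fun _ : unit => a).

Definition obranch (a : Ord) : Type := let: Ord_of K _ := a in K.

Definition ochild (a : Ord) : obranch a -> Ord :=
  match a with Ord_of _ f => f end.

(* sup_i sup_k (f i k + 1) is a supremum over pairs (i, k); see [osup_least]. *)
Definition osup (I : Type) (f : I -> Ord) : Ord :=
  Ord_of (fun p : {i : I & obranch (f i)} => ochild (projT2 p)).

Fixpoint Ord_of_nat (n : nat) : Ord :=
  if n is m.+1 then osucc (Ord_of_nat m) else ozero.

Lemma ole_refl a : ole a a.
Proof. by elim: a => I f IH /= i; exists i. Qed.

Lemma ole_trans b a c : ole a b -> ole b c -> ole a c.
Proof.
elim: a b c => I f IH [J g] [K h] /= ab bc i.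
by have [j fg] := ab i; have [k gh] := bc j; exists k; exact: IH fg gh.
Qed.

Lemma ole_total_lt a b : ole a b \/ olt b a.
Proof.
elim: a b => I f IH [J g].
have [ab|/existsNP[i ni]] := pselect (forall i, olt (f i) (Ord_of g)).
  by left.
right; exists i.
suff : forall j, olt (g j) (f i) by case: (f i).
by move=> j; have [fg|//] := IH i (g j); case: ni; exists j.
Qed.

Lemma olt_ole_trans b a c : olt a b -> ole b c -> olt a c.
Proof.
case: b c => [J g] [K h] [j ag] bc.
by have [k gh] := bc j; exists k; exact: ole_trans gh.
Qed.

Lemma ole_olt_trans b a c : ole a b -> olt b c -> olt a c.
Proof. by case: c => K h ab [k bh]; exists k; exact: ole_trans bh. Qed.

Lemma olt_wf : well_founded olt.
Proof.
move=> a; have [b ab] : exists b, ole a b by exists a; exact: ole_refl.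
elim: b a ab => J g IH a ab; constructor => c ca.
by have [j cg] := olt_ole_trans ca ab; exact: IH cg.
Qed.

Lemma osucc_least a b : ole (osucc a) b <-> olt a b.
Proof. by case: b => J g; split=> [/(_ tt)|ab []]. Qed.

Lemma osup_least (I : Type) (f : I -> Ord) b :
  ole (osup f) b <-> forall i, ole (f i) b.
Proof.
case: b => J g; split=> [sb i|fb [i p]] /=.
  move: sb => /= sb; have {}sb := fun p => sb (existT _ i p).
  by move: sb => /=; case: (f i).
by move: (fb i) p => /=; case: (f i) => K h /= + p => /(_ p).
Qed.

Section Rank.
Context {d : Order.disp_t} {P : porderType d}.
Hypothesis wfP : well_founded (fun x y : P => (x < y)%O).

Definition rk : P -> Ord :=
  Fix wfP (fun=> Ord) (fun x rec =>
    osup (fun y : {y : P | (y < x)%O} => osucc (rec (sval y) (svalP y)))).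

Lemma rkE x : rk x = osup (fun y : {y : P | (y < x)%O} => osucc (rk (sval y))).
Proof.
rewrite /rk Fix_eq// => {}x f g fg; congr osup.
by apply/funext => y; rewrite fg.
Qed.

Definition ordinal_rank : Ord := osup (fun x : P => osucc (rk x)).

End Rank.
Arguments rk {d P} wfP x.
Arguments ordinal_rank {d P} wfP.

HB.mixin Record isNoetherian T of Topological T := {
  open_is_compact : forall U : set T, open U -> compact U
}.

#[short(type="noetherianType")]
HB.structure Definition Noetherian := {T of Topological T & isNoetherian T}.

Definition irreducible_closed (X : topologicalType) (C : set X) : Prop :=
  [/\ closed C, C !=set0 &
      forall F1 F2 : set X, closed F1 -> closed F2 ->
        C `<=` F1 `|` F2 -> C `<=` F1 \/ C `<=` F2].

(* The order on [set X] is inclusion, see [subsetEset]. *)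
Definition irr_closed (X : topologicalType) : Type :=
  {C : set X | `[< irreducible_closed C >]}.
HB.instance Definition _ (X : topologicalType) :=
  SubChoice.on (irr_closed X).
HB.instance Definition _ (X : topologicalType) :=
  [SubChoice_isSubPOrder of irr_closed X by <: with set_display].

Lemma irr_closed_leE (X : topologicalType) (C D : irr_closed X) :
  (C <= D)%O = (val C `<=` val D) :> Prop.
Proof. by rewrite leEsub subsetEset. Qed.

Lemma irr_closed_wf (X : noetherianType) :
  well_founded (fun C D : irr_closed X => (C < D)%O).
Proof.
move=> C0; apply: contrapT => nC0.
pose bad := {C : irr_closed X | ~ Acc (fun C D : irr_closed X => (C < D)%O) C}.
have next (C : bad) : {D : bad | (sval D < sval C)%O}.
  apply: cid; case: C => C nC /=; apply: contrapT => nD.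
  apply: nC; constructor => D DC; apply: contrapT => accD.
  by apply: nD; exists (exist _ D accD).
pose c n : irr_closed X :=
  sval (iter n (fun C => sval (next C)) (exist _ C0 nC0)).
have cS n : (c n.+1 < c n)%O by rewrite /c iterS; exact: svalP (next _).
have cle m n : (m <= n)%N -> val (c n) `<=` val (c m).
  elim: n => [|n IH]; first by rewrite leqn0 => /eqP ->.
  rewrite leq_eqVlt => /predU1P[->//|/IH]; apply: subset_trans.
  by rewrite -irr_closed_leE; exact: ltW.
have cclosed n : closed (val (c n)).
  by have /asboolP[] := valP (c n).
pose U := \bigcup_n ~` val (c n).
have Uo : open U by apply: bigcup_open => n _; exact: closed_openC.
have UcN0 n : (U `&` val (c n)) !=set0.
  have [//|cU] := pselect ((U `&` val (c n)) !=set0).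
  have := cS n; rewrite lt_leAnge => /andP[_ /negP []].
  rewrite irr_closed_leE => x cx; apply: contrapT => ncx.
  by apply: cU; exists x; split => //; exists n.+1.
pose F : set_system X := [set A | exists n, U `&` val (c n) `<=` A].
have FF : ProperFilter F.
  split; first by move=> [n]; rewrite subset0 => E; move: (UcN0 n); rewrite E => -[].
  split; first by exists 0%N.
  - move=> A B [m mA] [n nB]; exists (maxn m n) => x [Ux cx]; split.
      by apply: mA; split => //; exact: cle (leq_maxl _ _) _ cx.
    by apply: nB; split => //; exact: cle (leq_maxr _ _) _ cx.
  - by move=> A B AB [n nA]; exists n; exact: subset_trans AB.
have [|x [[n _ cx] clx]] := @open_is_compact X U Uo F FF.
  by exists 0%N; exact: subIsetl.
have [||y [[_ yc] nyc]] := clx (U `&` val (c n)) (~` val (c n)).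
- by exists n.
- by apply: open_nbhs_nbhs; split => //; exact: closed_openC.
- exact: nyc.
Qed.

Definition sob (X : noetherianType) : Ord := ordinal_rank (@irr_closed_wf X).

Definition cofinite (X : Type) : Type := X.

Section Cofinite.
Variable X : Type.

HB.instance Definition _ := gen_eqMixin (cofinite X).
HB.instance Definition _ := gen_choiceMixin (cofinite X).

Definition cofinite_open (U : set (cofinite X)) : Prop :=
  U = set0 \/ finite_set (~` U).

Let cofinite_openT : cofinite_open setT.
Proof. by right; rewrite setCT. Qed.

Let cofinite_openI : setI_closed cofinite_open.
Proof.
move=> A B [->|Af]; first by left; rewrite set0I.
move=> [->|Bf]; first by left; rewrite setI0.
by right; rewrite setCI finite_setU.
Qed.

Let cofinite_open_bigU (I : Type) (f : I -> set (cofinite X)) :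
  (forall i, cofinite_open (f i)) -> cofinite_open (\bigcup_i f i).
Proof.
move=> fo; have [[i fi]|nf] := pselect (exists i, finite_set (~` f i)).
  by right; apply: sub_finite_set fi; apply: subsetC => x fx; exists i.
left; rewrite -subset0 => x [i _].
by have [->//|fi] := fo i; case: nf; exists i.
Qed.

HB.instance Definition _ := isOpenTopological.Build (cofinite X)
  cofinite_openT cofinite_openI cofinite_open_bigU.

Lemma open_cofinite (U : set (cofinite X)) :
  open U <-> U = set0 \/ finite_set (~` U).
Proof. by []. Qed.

Lemma closed_cofinite (C : set (cofinite X)) :
  closed C <-> finite_set C \/ C = setT.
Proof.
rewrite -openC open_cofinite setCK; split=> -[]; [|by left|by right|].
- by move=> E; right; rewrite -(setCK C) E setC0.
- by move=> ->; left; rewrite setCT.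
Qed.

Let cofinite_compact (U : set (cofinite X)) : open U -> compact U.
Proof.
move=> _ F FF FU; apply: contrapT => ncl.
have [x Ux] := filter_ex FU.
have [A [V [FA Vx AV]]] : exists A V, [/\ F A, nbhs x V & A `&` V = set0].
  apply: contrapT => nAV; apply: ncl; exists x; split => // A V FA Vx.
  apply: contrapT => AV; apply: nAV; exists A, V; split => //.
  by rewrite -subset0 => y AVy; apply: AV; exists y.
have AUf : finite_set (A `&` U).
  move: Vx; rewrite nbhsE => -[W [/open_cofinite [W0|Wf] Wx] WV].
    by move: Wx; rewrite W0.
  apply: sub_finite_set Wf => y [Ay _] Wy.
  by have : (A `&` V) y; [split => //; exact: WV | rewrite AV].
have FAU : F (A `&` U) by exact: filterI.
have [y [[_ Uy] cly]] := finite_compact AUf FF FAU.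
by apply: ncl; exists y.
Qed.

HB.instance Definition _ := isNoetherian.Build (cofinite X) cofinite_compact.

End Cofinite.

(* Main.v *)
Require Import Defs.
From mathcomp Require Import all_boot all_order.
From mathcomp Require Import all_classical topology.
Local Open Scope classical_set_scope.

(** In the cofinite topology the irreducible closed sets are the points [[set x]]
    and, when the space is infinite, the whole space ([finite_irreducible_closed1],
    [irreducible_closed1], [irreducible_closedT]).  Indeed a finite irreducible
    set C containing x is covered by the two finite, hence closed, sets [[set x]]
    and [C `\ x], and it is not contained in the second; and an infinite space is
    not the union of two finite sets.  Points are pairwise incomparable and lie
    strictly below the whole space when it is infinite, so the poset of
    irreducible closed sets is empty, a nonempty antichain, or a nonempty
    antichain with a top element added: its rank is 0, 1 or 2. *)

(** * Ranks in a well-founded poset *)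

Section Rank.
Context {d : Order.disp_t} {P : porderType d}.
Hypothesis wfP : well_founded (fun x y : P => (x < y)%O).

(** The defining suprema of the rank are handled only through their universal
    property: here, rk x is the least ordinal above all rk y with y < x. *)
Lemma rk_le x b :
  ole (rk wfP x) b <-> forall y, (y < x)%O -> olt (rk wfP y) b.
Proof.
rewrite rkE osup_least; split=> [xb y yx|xb [y yx]].
  exact/osucc_least/(xb (exist _ y yx)).
exact/osucc_least/xb.
Qed.

Lemma rk_lt x y : (x < y)%O -> olt (rk wfP x) (rk wfP y).
Proof. by move: x; apply/rk_le; exact: ole_refl. Qed.

Lemma ordinal_rank_le b :
  ole (ordinal_rank wfP) b <-> forall x, olt (rk wfP x) b.
Proof. by rewrite osup_least; split=> xb x; apply/osucc_least. Qed.

Lemma rk_lt_ordinal_rank x : olt (rk wfP x) (ordinal_rank wfP).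
Proof. by move: x; apply/ordinal_rank_le; exact: ole_refl. Qed.

End Rank.

Lemma ole0o a : ole ozero a.
Proof. by case: a => I f []. Qed.

Lemma olt_osucc a b : olt a (osucc b) <-> ole a b.
Proof. by split=> [[]|]; [|exists tt]. Qed.

(** * Irreducible closed sets in the cofinite topology *)

Definition Irr_closed {X : topologicalType} {C : set X}
  (irrC : irreducible_closed C) : irr_closed X := exist _ C (asboolT irrC).

Lemma irr_closedP {X : topologicalType} (C : irr_closed X) :
  irreducible_closed (val C).
Proof. exact/asboolP/(valP C). Qed.

Section IrreducibleCofinite.
Variable X : Type.
Implicit Type C : set (cofinite X).

Lemma finite_closed_cofinite C : finite_set C -> closed C.
Proof. by move=> finC; apply/closed_cofinite; left. Qed.

Lemma irreducible_closed1 (x : cofinite X) : irreducible_closed [set x].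
Proof.
split; [exact: finite_closed_cofinite (finite_set1 x)|by exists x|].
by move=> F1 F2 _ _ /(_ x erefl)[] Fx; [left|right] => y ->.
Qed.

(** Splitting off a point x covers a finite C by the closed sets [[set x]] and
    [C `\ x]; the second misses x, so irreducibility leaves the first. *)
Lemma finite_irreducible_closed1 C :
  finite_set C -> irreducible_closed C -> exists x, C = [set x].
Proof.
move=> finC [_ [x Cx] irrC]; exists x; apply/seteqP; split=> [|y ->//].
have C_cover : C `<=` [set x] `|` C `\ x.
  by move=> y Cy; have [->|yx] := pselect (y = x); [left|right].
have [| |//|/(_ x Cx)[_ /(_ erefl)//]] := irrC _ _ _ _ C_cover.
- exact: finite_closed_cofinite (finite_set1 x).
- by apply: finite_closed_cofinite; apply: sub_finite_set finC => y [].
Qed.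

(** A proper closed set is finite, and two finite sets cannot cover X. *)
Lemma irreducible_closedT :
  infinite_set [set: X] -> irreducible_closed [set: cofinite X].
Proof.
move=> infX; split; first exact: closedT.
  by apply/set0P/eqP => X0; apply: infX; rewrite [setT]X0.
move=> F1 F2 /closed_cofinite[fin1|->]; last by left.
move=> /closed_cofinite[fin2|->]; last by right.
by move=> F12; case: infX; apply: sub_finite_set F12 _; rewrite finite_setU.
Qed.

Lemma irr_closed_cofiniteP (C : irr_closed (cofinite X)) :
  (exists x, val C = [set x]) \/ infinite_set [set: X] /\ val C = setT.
Proof.
have irrC := irr_closedP C; have [finC|infC] := pselect (finite_set (val C)).
  by left; exact: finite_irreducible_closed1.
have [/closed_cofinite[//|CT] _ _] := irrC.
by right; split=> //; rewrite CT in infC.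
Qed.

(** A set strictly inside a point would be empty, and irreducible sets are not:
    hence points have rank 0. *)
Lemma irr_closed_lt1 {C D : irr_closed (cofinite X)} {x : cofinite X} :
  val C = [set x] -> ~ (D < C)%O.
Proof.
move=> Cx; rewrite Order.POrderTheory.lt_leAnge => /andP[DC /negP]; apply.
move: DC; rewrite !irr_closed_leE Cx => Dx y ->.
have [_ [z Dz] _] := irr_closedP D.
by rewrite -(Dx z Dz).
Qed.

Lemma rk_irr_closed1 (C : irr_closed (cofinite X)) (x : cofinite X) :
  val C = [set x] -> ole (rk (@irr_closed_wf (cofinite X)) C) ozero.
Proof. by move=> Cx; apply/rk_le => D /(irr_closed_lt1 Cx). Qed.

End IrreducibleCofinite.

(** * The sobrification rank *)

Theorem theorem7p1 (X : Type) :
  ([set: X] = set0 -> oeq (sob (cofinite X)) (Ord_of_nat 0)) /\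
  (finite_set [set: X] -> [set: X] !=set0 ->
     oeq (sob (cofinite X)) (Ord_of_nat 1)) /\
  (infinite_set [set: X] -> oeq (sob (cofinite X)) (Ord_of_nat 2)).
Proof.
split; last split.
- move=> X0; split; last exact: ole0o.
  apply/ordinal_rank_le => C; have [_ [x _] _] := irr_closedP C.
  by have : [set: X] x by []; rewrite X0.
- move=> finX [x _]; split.
    apply/ordinal_rank_le => C; apply/olt_osucc.
    have [[y Cy]|[//]] := irr_closed_cofiniteP X C.
    exact: rk_irr_closed1 Cy.
  apply/osucc_least/(ole_olt_trans (ole0o _)).
  exact: rk_lt_ordinal_rank (Irr_closed (irreducible_closed1 X x)).
- move=> infX; pose T := Irr_closed (irreducible_closedT X infX).
  split.
    (* Anything strictly below another irreducible closed set is not the whole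
       space, so it is a point. *)
    apply/ordinal_rank_le => C; apply/olt_osucc/rk_le => D DC.
    apply/olt_osucc.
    have [[y Dy]|[_ DT]] := irr_closed_cofiniteP X D.
      exact: rk_irr_closed1 Dy.
    move: DC; rewrite Order.POrderTheory.lt_leAnge => /andP[_ /negP[]].
    by rewrite irr_closed_leE DT.
  (* The chain from a point to the whole space forces the rank to be at least 2. *)
  apply/osucc_least; apply: ole_olt_trans (rk_lt_ordinal_rank _ T).
  have [_ [x _] _] := irr_closedP T.
  apply/osucc_least/(ole_olt_trans (ole0o _)).
  apply: (@rk_lt _ _ _ (Irr_closed (irreducible_closed1 X x)) T).
  rewrite Order.POrderTheory.lt_leAnge; apply/andP; split.
    by rewrite irr_closed_leE.
  apply/negP; rewrite irr_closed_leE => Tx; apply: (infX).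
  exact: sub_finite_set Tx (finite_set1 x).
Qed.
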